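(* Let $R>0$, $t_0\in(0,1)$, $t_1=1-t_0$, $\alpha_0>0$, $\alpha_1>0$. Assume that the quantization squared-error distortion $\Delta^2(\rho)>0$ and the relay power $\phi(\rho)>0$ of the DoQF protocol are chosen such that $$\lim_{\rho\to\infty}\phi(\rho)=+\infty,\qquad \lim_{\rho\to\infty}\frac{\phi(\rho)}{\rho^2}=0,\qquad \lim_{\rho\to\infty}\Delta^2(\rho)=0,\qquad \lim_{\rho\to\infty}\left(\phi(\rho)^{t_1}\,\Delta^2(\rho)^{t_0}\right)=+\infty .$$ (In particular, the condition $\phi(\rho)/\rho^2\to0$ ensures that the DoQF protocol belongs to the class $\mathcal{P}_{\mathrm{HD}}(t_0,\alpha_0,\alpha_1)$.) Then the outage gain $\xi_{\mathrm{DoQF}}=\lim_{\rho\to\infty}\rho^2P_o(\rho)$ of the DoQF protocol exists and equals $\xi_{\mathrm{CS-HD}}$: $$\xi_{\mathrm{DoQF}}=\frac{c_{02}c_{01}}{\alpha_0^2}\left(\frac12+\frac{\exp(2R)}{4t_0-2}-\frac{t_0\exp(R/t_0)}{2t_0-1}\right)+\frac{c_{02}c_{12}}{\alpha_0\alpha_1}\left(\frac12+\frac{\exp(2R)}{4t_1-2}-\frac{t_1\exp(R/t_1)}{2t_1-1}\right).$$ (For $t_0=t_1=\frac12$ each parenthesis is read as its limit $\frac12-\frac12e^{2R}+Re^{2R}$.)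
   Context: Channels. Node 0 is the source, node 1 the relay, node 2 the destination. The channel coefficients $H_{01},H_{02},H_{12}$ are independent complex random variables, and $G_{ij}=|H_{ij}|^2$. Each $G_{ij}$ has a density $f_{G_{ij}}$ that is right-continuous at zero, and $c_{ij}=f_{G_{ij}}(0^+)>0$. Noises have i.i.d. $\mathcal{CN}(0,1)$ components. The rate $R$ (nats per channel use) does not depend on the SNR $\rho$. DoQF (Decode or Quantize and Forward) protocol. In a frame of $T$ channel uses, the source transmits $\sqrt{\alpha_0\rho}\,[X_{00}^{\mathrm T},X_{01}^{\mathrm T}]^{\mathrm T}$ (lengths $t_0T$ and $t_1T$), a codeword from a Gaussian codebook of $\lfloor e^{RT}\rfloor$ words with i.i.d. $\mathcal{CN}(0,1)$ entries. The relay listens during slot 0 (the first $t_0T$ uses). - If the event $\mathcal{E}=\{t_0\log(1+\alpha_0\rho G_{01})>R\}$ holds, the relay decodes and transmits during slot 1 (the last $t_1T$ uses) $\sqrt{\alpha_1\rho}\,X_{11}$, with $X_{11}$ from an independent unit-power Gaussian codebook. - If $\overline{\mathcal{E}}$ and $\mathcal{S}=\{\alpha_0\rho G_{01}+1>\Delta^2(\rho)\}$ hold, the relay quantizes its received vector with squared-error distortion $\Delta^2(\rho)$ per component, using $Q(\rho)=\log(K/\Delta^2(\rho))$ nats per component with $K=e^{R/t_0}$, and transmits in slot 1 the quantization index with a Gaussian codeword at power $\phi(\rho)$. The destination recovers the quantized vector, treating the source signal as noise, iff the following event holds: $$\mathcal{F}=\left\{t_1\log\left(1+\frac{\phi(\rho)G_{12}}{\alpha_0\rho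 G_{02}+1}\right)>Q(\rho)t_0\right\}.$$ If it does not recover it, it uses only its slot 0 observation. - If $\overline{\mathcal{E}}$ and $\overline{\mathcal{S}}$ hold, the relay stays silent. The outage probability of the DoQF protocol is accordingly $P_o(\rho)=P_{o,1}(\rho)+P_{o,2}(\rho)+P_{o,3}(\rho)+P_{o,4}(\rho)$, where, with $\gamma(G_{01},\rho)=\frac{(1+\alpha_0\rho G_{01}-\Delta^2(\rho))^2}{(1+\alpha_0\rho G_{01})^2}$, $$P_{o,1}=\Pr[t_0\log(1+\alpha_0\rho G_{02})+t_1\log(1+\alpha_0\rho G_{02}+\alpha_1\rho G_{12})\le R]\,(1-\Pr[\overline{\mathcal{E}}]),$$ $$P_{o,2}=\Pr\left[t_1\log(1+\alpha_0\rho G_{02})+t_0\log\left(1+\alpha_0\rho G_{02}+\frac{\gamma(G_{01},\rho)\alpha_0\rho G_{01}}{\gamma(G_{01},\rho)+\Delta^2(\rho)\sqrt{\gamma(G_{01},\rho)}}\right)\le R,\ \overline{\mathcal{E}},\mathcal{F},\mathcal{S}\right],$$ $$P_{o,3}=\Pr[t_0\log(1+\alpha_0\rho G_{02})\le R,\ \overline{\mathcal{E}},\overline{\mathcal{F}},\mathcal{S}],\qquad P_{o,4}=\Pr[\log(1+\alpha_0\rho G_{02})\le R,\ \overline{\mathcal{E}},\overline{\mathcal{S}}].$$ Class $\mathcal{P}_{\mathrm{HD}}(t_0,\alpha_0,\alpha_1)$: the half-duplex relaying protocols with a source dictionary of $\lfloor e^{RT}\rfloor$ codewords of length $T$, in which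 the relay listens exactly during the first $t_0T$ channel uses (fixed, independent of the channel realizations) and transmits codewords of length $(1-t_0)T$ during the remaining uses, and such that, as $\rho\to\infty$, the limit of (average source transmit power over the $T$ uses)$/\rho$ is at most $\alpha_0$ and the limit of (average relay transmit power over the last $(1-t_0)T$ uses)$/\rho$ is at most $\alpha_1$. For DoQF the source power is $\alpha_0\rho$ and the average relay power in slot 1 is $\alpha_1\rho(1-\Pr[\overline{\mathcal{E}}])+\phi(\rho)\Pr[\overline{\mathcal{E}},\mathcal{S}]$. *)

(* Defs.v *)
From HB Require Import structures.
From mathcomp Require Import all_boot all_order all_algebra.
From mathcomp Require Import all_classical all_reals all_analysis.
From mathcomp Require Import complex.

Set Implicit Arguments.
Unset Strict Implicit.
Unset Printing Implicit Defensive.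

Import Order.TTheory GRing.Theory Num.Theory.
Import numFieldNormedType.Exports.

Local Open Scope classical_set_scope.
Local Open Scope ring_scope.

Section Channels.
Context {R : realType} {d : measure_display} {Omega : measurableType d}.
Variable P : probability Omega R.
Implicit Types H : Omega -> R[i].

(* R[i] carries no measurable structure in the libraries; its Borel
   sigma-algebra is the one transported from R * R. *)
Definition re_im H : Omega -> R * R :=
  fun w => (complex.Re (H w), complex.Im (H w)).

Definition complex_rv H : Prop := measurable_fun setT (re_im H).

(* Taking some of the sets equal to setT gives the product rule for pairs. *)
Definition mutually_independent3 H1 H2 H3 : Prop :=
  forall A1 A2 A3 : set (R * R),
    measurable A1 -> measurable A2 -> measurable A3 ->
    P (re_im H1 @^-1` A1 `&` re_im H2 @^-1` A2 `&` re_im H3 @^-1` A3) =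
    (P (re_im H1 @^-1` A1) * P (re_im H2 @^-1` A2) * P (re_im H3 @^-1` A3))%E.

Definition gain H : Omega -> R := fun w => ComplexField.Normc.normc (H w) ^+ 2.

Definition is_density (X : Omega -> R) (f : R -> R) : Prop :=
  [/\ measurable_fun setT f,
      forall x, 0 <= f x &
      forall A : set R, measurable A ->
        P (X @^-1` A) = (\int[lebesgue_measure]_(x in A) (f x)%:E)%E].

Definition Pr (A : set Omega) : R := fine (P A).

End Channels.

Definition right_lim0 {R : realType} (f : R -> R) : R :=
  lim (f x @[x --> 0^'+]).

Definition right_continuous0 {R : realType} (f : R -> R) : Prop :=
  f x @[x --> 0^'+] --> f 0.

Section DoQF.
Context {R : realType} {d : measure_display} {Omega : measurableType d}.
Variable P : probability Omega R.
Variables G01 G02 G12 : Omega -> R.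
Variables rate t0 alpha0 alpha1 : R.
(* [Delta2 rho] is the distortion itself, written as a square on paper. *)
Variables Delta2 phi : R -> R.

Let t1 : R := 1 - t0.

Definition decode_event (rho : R) : set Omega :=
  [set w | t0 * ln (1 + alpha0 * rho * G01 w) > rate].

Definition quantize_event (rho : R) : set Omega :=
  [set w | alpha0 * rho * G01 w + 1 > Delta2 rho].

Definition quantization_rate (rho : R) : R := ln (expR (rate / t0) / Delta2 rho).

Definition recover_event (rho : R) : set Omega :=
  [set w | t1 * ln (1 + phi rho * G12 w / (alpha0 * rho * G02 w + 1))
           > quantization_rate rho * t0].

Definition gamma (g rho : R) : R :=
  (1 + alpha0 * rho * g - Delta2 rho) ^+ 2 / (1 + alpha0 * rho * g) ^+ 2.

Definition outage_decode (rho : R) : R :=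
  Pr P [set w | t0 * ln (1 + alpha0 * rho * G02 w)
                + t1 * ln (1 + alpha0 * rho * G02 w + alpha1 * rho * G12 w)
                <= rate]
  * (1 - Pr P (~` decode_event rho)).

Definition outage_quantize (rho : R) : R :=
  Pr P ([set w | t1 * ln (1 + alpha0 * rho * G02 w)
                 + t0 * ln (1 + alpha0 * rho * G02 w
                     + gamma (G01 w) rho * alpha0 * rho * G01 w
                       / (gamma (G01 w) rho
                          + Delta2 rho * Num.sqrt (gamma (G01 w) rho)))
                 <= rate]
        `&` ~` decode_event rho `&` recover_event rho `&` quantize_event rho).

Definition outage_unrecovered (rho : R) : R :=
  Pr P ([set w | t0 * ln (1 + alpha0 * rho * G02 w) <= rate]
        `&` ~` decode_event rho `&` ~` recover_event rho
        `&` quantize_event rho).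

Definition outage_silent (rho : R) : R :=
  Pr P ([set w | ln (1 + alpha0 * rho * G02 w) <= rate]
        `&` ~` decode_event rho `&` ~` quantize_event rho).

Definition outage_probability (rho : R) : R :=
  outage_decode rho + outage_quantize rho
  + outage_unrecovered rho + outage_silent rho.

(* Average of the relay power over the last [(1 - t0) * T] channel uses. *)
Definition doqf_relay_power (rho : R) : R :=
  alpha1 * rho * (1 - Pr P (~` decode_event rho))
  + phi rho * Pr P (~` decode_event rho `&` quantize_event rho).

End DoQF.

(* A half-duplex relay either listens or transmits in each channel use.  For a
   frame of T channel uses numbered from 0, [relay_listens T w k] says which of
   the two happens in use k; it may a priori depend on the outcome w, that is,
   on the channel realization.  The powers are averages, as functions of the
   SNR: over the whole frame for the source, and over the channel uses in which
   the relay does not listen for the relay. *)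
Record hd_protocol (R : realType) (Omega : Type) := HDProtocol {
  dictionary_size : nat -> nat ;
  relay_listens : nat -> Omega -> nat -> bool ;
  source_power : R -> R ;
  relay_power : R -> R }.

Definition in_PHD (R : realType) (Omega : Type) (rate t0 alpha0 alpha1 : R)
    (p : hd_protocol R Omega) : Prop :=
  [/\ forall T : nat, dictionary_size p T = Num.truncn (expR (rate * T%:R)),
      forall (T : nat) (w : Omega) (k : nat), (k < T)%N ->
        relay_listens p T w k = (k%:R < t0 * T%:R),
      exists2 l : R, source_power p rho / rho @[rho --> +oo] --> l
                     & l <= alpha0 &
      exists2 l : R, relay_power p rho / rho @[rho --> +oo] --> l
                     & l <= alpha1].

Definition doqf_protocol {R : realType} {d : measure_display}
    {Omega : measurableType d} (P : probability Omega R)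
    (G01 : Omega -> R) (rate t0 alpha0 alpha1 : R) (Delta2 phi : R -> R) :
    hd_protocol R Omega :=
  {| dictionary_size := fun T => Num.truncn (expR (rate * T%:R)) ;
     relay_listens := fun T _ k => k%:R < t0 * T%:R ;
     source_power := fun rho => alpha0 * rho ;
     relay_power := doqf_relay_power P G01 rate t0 alpha0 alpha1 Delta2 phi |}.

(* At t = 1/2 the generic expression is singular; the value is its limit. *)
Definition gain_bracket {R : realType} (rate t : R) : R :=
  if t == 1 / 2 then 1 / 2 - 1 / 2 * expR (2 * rate) + rate * expR (2 * rate)
  else 1 / 2 + expR (2 * rate) / (4 * t - 2)
       - t * expR (rate / t) / (2 * t - 1).

Definition xi_CS_HD {R : realType} (c01 c02 c12 rate t0 alpha0 alpha1 : R) : R :=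
  c02 * c01 / alpha0 ^+ 2 * gain_bracket rate t0
  + c02 * c12 / (alpha0 * alpha1) * gain_bracket rate (1 - t0).

(* Main.v *)
(* After scaling by the SNR, each gain has near zero the distribution function
   of c times Lebesgue measure, c being its density at 0^+.  The outage events
   of the two leading terms (the relay decodes; the relay quantizes and the
   destination recovers the index) then have a probability rho^-2 times the area
   of a planar region {s ln (1 + u) + t ln (1 + u + v) <= R}; since the gains are
   independent, squeezing this region between unions of rectangles suffices,
   without product measures.  Quantization only perturbs the second region,
   because the effective SNR lies in [(1 - Delta2) v, v].  Failing to recover the
   index forces G12 to be small on the event where G01 and G02 are O(1/rho), as
   phi^t1 Delta2^t0 tends to infinity, hence contributes o(rho^-2); and the relay
   is never silent once Delta2 < 1. *)
Require Import Defs.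
From HB Require Import structures.
From mathcomp Require Import all_boot all_order all_algebra.
From mathcomp Require Import all_classical all_reals all_analysis.
From mathcomp Require Import complex.
From mathcomp Require Import measurable_realfun ring lra.

Set Implicit Arguments.
Unset Strict Implicit.
Unset Printing Implicit Defensive.

Import Order.TTheory GRing.Theory Num.Theory.
Import numFieldNormedType.Exports.

Local Open Scope classical_set_scope.
Local Open Scope ring_scope.

(** * Probabilities and distribution functions near zero *)

Lemma Pr_ge0 (R : realType) (d : measure_display) (Omega : measurableType d)
    (P : probability Omega R) (A : set Omega) : 0 <= Pr P A.
Proof. exact/fine_ge0/measure_ge0. Qed.

Lemma EFin_Pr (R : realType) (d : measure_display) (Omega : measurableType d)
    (P : probability Omega R) (A : set Omega) :
  measurable A -> (Pr P A)%:E = P A.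
Proof. by move=> mA; rewrite /Pr fineK// fin_num_measure. Qed.

Lemma le_Pr (R : realType) (d : measure_display) (Omega : measurableType d)
    (P : probability Omega R) (A B : set Omega) :
  measurable A -> measurable B -> A `<=` B -> Pr P A <= Pr P B.
Proof.
by move=> mA mB AB; rewrite -lee_fin !EFin_Pr//; apply: le_measure; rewrite ?inE.
Qed.

Lemma Pr_setID (R : realType) (d : measure_display) (Omega : measurableType d)
    (P : probability Omega R) (A B : set Omega) :
  measurable A -> measurable B ->
  Pr P A = Pr P (A `&` B) + Pr P (A `&` ~` B).
Proof.
move=> mA mB; apply: EFin_inj; rewrite EFinD !EFin_Pr//; last 2 first.
- by apply: measurableI => //; exact: measurableC.
- exact: measurableI.
by rewrite (measureDI P mA mB) addeC setDE.
Qed.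

Lemma measurable_le_set (d : measure_display) (T : measurableType d)
    (R : realType) (f g : T -> R) :
  measurable_fun setT f -> measurable_fun setT g ->
  measurable [set x | f x <= g x].
Proof.
move=> mf mg; have := measurable_fun_ler mf mg measurableT (Y := [set true]) I.
by rewrite setTI; congr measurable; apply/seteqP; split => x /=.
Qed.

Lemma measurable_lt_set (d : measure_display) (T : measurableType d)
    (R : realType) (f g : T -> R) :
  measurable_fun setT f -> measurable_fun setT g ->
  measurable [set x | f x < g x].
Proof.
move=> mf mg; have := measurable_fun_ltr mf mg measurableT (Y := [set true]) I.
by rewrite setTI; congr measurable; apply/seteqP; split => x /=.
Qed.

(** On nonnegative reals the inverse is the power of exponent -1, whose measurability is known; at 0
    both equal 0 by convention. *)
Lemma measurable_fun_inv_ge0 (d : measure_display) (T : measurableType d)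
    (R : realType) (f : T -> R) :
  (forall x, 0 <= f x) -> measurable_fun setT f ->
  measurable_fun setT (fun x => (f x)^-1).
Proof.
move=> f0 mf; have -> : (fun x => (f x)^-1) = (@powR R ^~ (-1)) \o f.
  by apply/funext => x /=; rewrite powR_inv1.
exact: measurableT_comp (measurable_powR _) mf.
Qed.

Lemma measurable_fun_sqrt_ge0 (d : measure_display) (T : measurableType d)
    (R : realType) (f : T -> R) :
  (forall x, 0 <= f x) -> measurable_fun setT f ->
  measurable_fun setT (fun x => Num.sqrt (f x)).
Proof.
move=> f0 mf; have -> : (fun x => Num.sqrt (f x)) = (@powR R ^~ 2^-1) \o f.
  by apply/funext => x /=; rewrite powR12_sqrt.
exact: measurableT_comp (measurable_powR _) mf.
Qed.

(** All that the asymptotics retain of a density. The scaled form composes directly with any scaling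
    of the SNR that tends to infinity. *)
Definition linear_cdf0 (R : realType) (d : measure_display)
    (Omega : measurableType d) (P : probability Omega R)
    (X : Omega -> R) (c : R) : Prop :=
  forall u, 0 <= u -> r * Pr P [set w | r * X w <= u] @[r --> +oo] --> c * u.

Definition independent2 (R : realType) (d : measure_display)
    (Omega : measurableType d) (P : probability Omega R)
    (X Y : Omega -> R) : Prop :=
  forall A B : set R, measurable A -> measurable B ->
    Pr P (X @^-1` A `&` Y @^-1` B) = Pr P (X @^-1` A) * Pr P (Y @^-1` B).

(** For large [r] the interval [[0, u / r]] lies where right-continuity keeps [f] within [k] of
    [f 0], so its probability is between [(f 0 - k) * (u / r)] and [(f 0 + k) * (u / r)]. *)
Lemma density_linear_cdf0 (R : realType) (d : measure_display)
    (Omega : measurableType d) (P : probability Omega R) (X : Omega -> R)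
    (f : R -> R) :
  measurable_fun setT X -> (forall w, 0 <= X w) -> is_density P X f ->
  right_continuous0 f -> linear_cdf0 P X (right_lim0 f).
Proof.
move=> mX X0 [mf f0 fP] rcf u u0.
have -> : right_lim0 f = f 0 by exact: (cvg_lim (@Rhausdorff R) rcf).
apply/cvgrPdist_le => e e0.
(* The denominator [u + 1] ensures [k * u <= e] and stays positive when [u = 0]. *)
pose k := e / (u + 1).
have k0 : 0 < k by rewrite divr_gt0// ltr_wpDl.
have [dl /= dl0 Hdl] := (cvgrPdist_le _ _).1 rcf k k0.
have Hf x : 0 <= x -> x < dl -> `|f 0 - f x| <= k.
  rewrite le_eqVlt => /predU1P[<- _|x0 xd]; first by rewrite subrr normr0 ltW.
  by apply: Hdl => //=; rewrite sub0r normrN gtr0_norm.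
near=> r.
have r0 : 0 < r by near: r; apply: nbhs_pinfty_gt; rewrite num_real.
have hd : u / r < dl.
  rewrite ltr_pdivrMr// mulrC -ltr_pdivrMr//.
  by near: r; apply: nbhs_pinfty_gt; rewrite num_real.
have h0 : 0 <= u / r by rewrite divr_ge0// ltW.
have -> : [set w | r * X w <= u] = X @^-1` `[0, u / r].
  by apply/seteqP; split => w /=; rewrite in_itv/= X0/= ler_pdivlMr// mulrC.
have mI : measurable (`[0, u / r]%classic : set R) by [].
have PE : (Pr P (X @^-1` `[0, u / r]))%:E =
    (\int[lebesgue_measure]_(x in (`[0%R, (u / r)%R]%classic : set R)) (f x)%:E)%E.
  rewrite EFin_Pr ?fP// -[X in measurable X]setTI; exact: mX.
have intc m : (\int[lebesgue_measure]_(x in (`[0%R, (u / r)%R]%classic : set R)) m%:E)%E =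
    (m * (u / r))%:E :> \bar R.
  have /= -> := integral_cst (@lebesgue_measure R) mI m%:E.
  rewrite lebesgue_measure_itv/= lte_fin.
  case: ifPn => [_|]; first by rewrite sube0.
  rewrite -leNgt => h0'; have -> : u / r = 0 by apply/eqP; rewrite eq_le h0'.
  by rewrite mulr0 mule0.
have mfE : measurable_fun `[0, u / r] (EFin \o f).
  by apply/measurable_EFinP; exact: measurable_funTS.
have up : Pr P (X @^-1` `[0, u / r]) <= (f 0 + k) * (u / r).
  rewrite -lee_fin PE -intc; apply: ge0_le_integral => //.
  - by move=> x _; rewrite lee_fin.
  - move=> x /=; rewrite in_itv/= => /andP[x0 xh]; rewrite lee_fin.
    by have := Hf x x0 (le_lt_trans xh hd); rewrite ler_norml; lra.
have lo : (f 0 - k) * (u / r) <= Pr P (X @^-1` `[0, u / r]).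
  (* Monotonicity of the integral is applied to nonnegative integrands, and [f 0 - k] may be
     negative. *)
  apply: (@le_trans _ _ (Num.max 0 (f 0 - k) * (u / r))).
    by rewrite ler_wpM2r// le_max lexx orbT.
  rewrite -lee_fin PE -intc; apply: ge0_le_integral => //.
  - by move=> x _; rewrite lee_fin le_max lexx.
  - move=> x /=; rewrite in_itv/= => /andP[x0 xh]; rewrite lee_fin ge_max f0/=.
    by have := Hf x x0 (le_lt_trans xh hd); rewrite ler_norml; lra.
have ku : k * u <= e.
  by rewrite /k mulrAC ler_pdivrMr ?ltr_wpDl// ler_pM2l// lerDl.
have rr : r * (u / r) = u by rewrite mulrCA divff ?mulr1// gt_eqF.
have up' : r * Pr P (X @^-1` `[0, u / r]) <= (f 0 + k) * u.
  by rewrite -[in leRHS]rr mulrCA ler_pM2l.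
have lo' : (f 0 - k) * u <= r * Pr P (X @^-1` `[0, u / r]).
  by rewrite -[in leLHS]rr mulrCA ler_pM2l.
by rewrite ler_norml; lra.
Unshelve. all: by end_near.
Qed.

(** * Scaled probabilities of planar regions *)

(** The two bounds may change with [e] and need not share a limit. This allows letting the SNR go to
    infinity for a fixed subdivision, and refining the subdivision afterwards. *)
Lemma approx_squeeze_cvgr (R : realFieldType) (T : Type) (F : set_system T)
    (FF : Filter F) (f : T -> R) (l : R) :
  (forall e, 0 < e -> exists g h : T -> R, exists lg lh : R,
    [/\ \forall x \near F, g x <= f x <= h x,
        g @ F --> lg, h @ F --> lh, l - e <= lg & lh <= l + e]) ->
  f @ F --> l.
Proof.
move=> H; apply/cvgrPdist_le => e e0.
have e20 : 0 < e / 2 by rewrite divr_gt0.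
have [g [h [lg [lh [gfh gl hl lgl lhl]]]]] := H _ e20.
near=> x.
have /andP[gf fh] : g x <= f x <= h x by near: x.
have : `|lg - g x| <= e / 2 by near: x; exact: (cvgrPdist_le _ _).1 gl _ e20.
have : `|lh - h x| <= e / 2 by near: x; exact: (cvgrPdist_le _ _).1 hl _ e20.
rewrite !ler_norml => /andP[? ?] /andP[? ?].
by apply/andP; split; lra.
Unshelve. all: by end_near.
Qed.

Lemma cvgr_sum_ord (R : realFieldType) (T : Type) (F : set_system T)
    (FF : Filter F) (n : nat) (f : nat -> T -> R) (l : nat -> R) :
  (forall i, (i < n)%N -> f i @ F --> l i) ->
  (fun x => \sum_(i < n) f i x) @ F --> \sum_(i < n) l i.
Proof.
elim: n => [_|n IH fl].
  by under eq_fun do rewrite big_ord0; rewrite big_ord0; exact: cvg_cst.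
under eq_fun do rewrite big_ord_recr/=.
rewrite big_ord_recr/=; apply: cvgD; last exact: fl.
by apply: IH => i ltin; apply: fl; exact: leqW.
Qed.

(** The differences [S i.+1 \ S i] will be the vertical strips of a Riemann sum. *)
Lemma Pr_filtration (R : realType) (d : measure_display)
    (Omega : measurableType d) (P : probability Omega R) (E : set Omega)
    (S : nat -> set Omega) (n : nat) :
  measurable E -> (forall i, measurable (S i)) ->
  (forall i, S i `<=` S i.+1) ->
  Pr P (E `&` S n) =
    Pr P (E `&` S 0%N) + \sum_(i < n) Pr P (E `&` (S i.+1 `&` ~` S i)).
Proof.
move=> mE mS sS; elim: n => [|n IH]; first by rewrite big_ord0 addr0.
rewrite big_ord_recr/= addrA -IH (Pr_setID P (measurableI _ _ mE (mS n.+1)) (mS n)).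
by rewrite -!setIA (setIidr (sS n)).
Qed.

Lemma Pr_shell (R : realType) (d : measure_display)
    (Omega : measurableType d) (P : probability Omega R) (S T : set Omega) :
  measurable S -> measurable T -> S `<=` T ->
  Pr P (T `&` ~` S) = Pr P T - Pr P S.
Proof.
by move=> mS mT ST; rewrite (Pr_setID P mT mS) (setIidr ST) addrC addKr.
Qed.

(* Only rectangle probabilities are used: the region is squeezed between the
   rectangles of the lower and upper Riemann sums of [psi]. *)
Lemma Pr_subgraph_cvg (R : realType) (d : measure_display)
    (Omega : measurableType d) (P : probability Omega R)
    (X Y : Omega -> R) (cX cY : R) (psi F : R -> R) (U : R)
    (a b : R -> R) (E : R -> set Omega) :
  measurable_fun setT X -> measurable_fun setT Y ->
  (forall w, 0 <= X w) -> independent2 P X Y ->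
  linear_cdf0 P X cX -> linear_cdf0 P Y cY -> 0 <= cX -> 0 <= cY ->
  0 <= U ->
  (forall x y, 0 <= x -> x <= y -> y <= U -> psi y <= psi x) ->
  (forall x, 0 <= x -> x <= U -> 0 <= psi x) ->
  (forall x y, 0 <= x -> x <= y -> y <= U ->
    psi y * (y - x) <= F y - F x <= psi x * (y - x)) ->
  a r @[r --> +oo] --> +oo -> b r @[r --> +oo] --> +oo ->
  (forall r, measurable (E r)) ->
  (\forall r \near +oo,
    E r = [set w | a r * X w <= U /\ b r * Y w <= psi (a r * X w)]) ->
  a r * b r * Pr P (E r) @[r --> +oo] --> cX * cY * (F U - F 0).
Proof.
move=> mX mY X0 XY lX lY cX0 cY0 U0 psi_ni psi_ge0 psiF ay by_ mE EE.
apply: approx_squeeze_cvgr => e e0.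
(* With [n.+1] strips of equal width, the upper and lower Riemann sums of the monotone [psi] differ
   by [U * (psi 0 - psi U) / n.+1]. *)
have [n nP] : exists n : nat, cX * cY * (U * (psi 0 - psi U)) <= e * n.+1%:R.
  exists (Num.truncn (cX * cY * (U * (psi 0 - psi U)) / e)).
  by rewrite [leRHS]mulrC -ler_pdivrMr//; exact/ltW/truncnS_gt.
set N := n.+1 in nP *.
have N0 : 0 < N%:R :> R by rewrite ltr0n.
pose s i := U * i%:R / N%:R.
have sS i : s i.+1 - s i = U / N%:R.
  by rewrite /s -mulrBl -mulrBr -natr1 addrAC subrr add0r mulr1.
have s00 : s 0%N = 0 by rewrite /s mulr0 mul0r.
have sN : s N = U by rewrite /s mulfK// gt_eqF.
have dU : 0 <= U / N%:R by rewrite divr_ge0// ltW.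
have s_ge0 i : 0 <= s i by rewrite /s divr_ge0 ?mulr_ge0// ltW.
have s_le i : s i <= s i.+1 by rewrite -subr_ge0 sS.
have s_leU i : (i <= N)%N -> s i <= U.
  by move=> iN; rewrite /s ler_pdivrMr// ler_wpM2l// ler_nat.
pose A i r := a r * Pr P [set w | a r * X w <= s i].
pose B i r := b r * Pr P [set w | b r * Y w <= psi (s i)].
have Al i : A i r @[r --> +oo] --> cX * s i.
  exact: (cvg_comp _ _ ay (lX (s i) (s_ge0 i))).
have Bl i : (i <= N)%N -> B i r @[r --> +oo] --> cY * psi (s i).
  by move=> iN; apply: (cvg_comp _ _ by_ (lY _ (psi_ge0 _ (s_ge0 i) (s_leU i iN)))).
(* The strips are open on the left, so they miss the line where the first variable is 0. The upper
   bound covers it by the extra term of index 0, whose limit is 0; the lower bound omits it. *)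
pose lo r := \sum_(i < N) (A i.+1 r - A i r) * B i.+1 r.
pose up r := A 0%N r * B 0%N r + \sum_(i < N) (A i.+1 r - A i r) * B i r.
pose llo := \sum_(i < N) (cX * s i.+1 - cX * s i) * (cY * psi (s i.+1)).
pose lup := cX * s 0%N * (cY * psi (s 0%N)) +
  \sum_(i < N) (cX * s i.+1 - cX * s i) * (cY * psi (s i)).
exists lo, up, llo, lup.
have FE : F U - F 0 = \sum_(i < N) (F (s i.+1) - F (s i)).
  by rewrite -(big_mkord xpredT (fun i => F (s i.+1) - F (s i))) telescope_sumr// sN s00.
have Fge : F U - F 0 >= \sum_(i < N) (U / N%:R) * psi (s i.+1).
  rewrite FE; apply: ler_sum => i _.
  have := psiF _ _ (s_ge0 i) (s_le i) (s_leU i.+1 (ltn_ord i)).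
  by rewrite sS mulrC => /andP[].
have Fle : F U - F 0 <= \sum_(i < N) (U / N%:R) * psi (s i).
  rewrite FE; apply: ler_sum => i _.
  have := psiF _ _ (s_ge0 i) (s_le i) (s_leU i.+1 (ltn_ord i)).
  by rewrite sS => /andP[_]; rewrite mulrC.
have gap : \sum_(i < N) (U / N%:R) * psi (s i) -
    \sum_(i < N) (U / N%:R) * psi (s i.+1) = U / N%:R * (psi 0 - psi U).
  rewrite -!mulr_sumr -mulrBr; congr (_ * _).
  rewrite -opprB -sumrB.
  rewrite -(big_mkord xpredT (fun i => psi (s i.+1) - psi (s i))).
  by rewrite (telescope_sumr (fun i => psi (s i)))// sN s00 opprB.
have lloE : llo = cX * cY * \sum_(i < N) (U / N%:R) * psi (s i.+1).
  rewrite mulr_sumr; apply: eq_bigr => i _; rewrite -mulrBr sS; ring.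
have lupE : lup = cX * cY * \sum_(i < N) (U / N%:R) * psi (s i).
  rewrite /lup s00 mulr0 mul0r add0r.
  rewrite mulr_sumr; apply: eq_bigr => i _; rewrite -mulrBr sS; ring.
have gape : cX * cY * (U / N%:R * (psi 0 - psi U)) <= e.
  rewrite -[leRHS](mulfK (lt0r_neq0 N0)) ler_pdivlMr//.
  rewrite [leLHS](_ : _ = cX * cY * (U * (psi 0 - psi U)))//.
  by field; exact: lt0r_neq0.
have cc0 : 0 <= cX * cY by rewrite mulr_ge0.
have gapM : cX * cY * (\sum_(i < N) (U / N%:R) * psi (s i)) =
    cX * cY * (\sum_(i < N) (U / N%:R) * psi (s i.+1)) +
    cX * cY * (U / N%:R * (psi 0 - psi U)).
  by rewrite -gap -mulrDr addrCA subrr addr0.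
split.
- near=> r.
  have ar0 : 0 < a r by near: r; exact: (cvgryPgt _).1 ay 0.
  have br0 : 0 < b r by near: r; exact: (cvgryPgt _).1 by_ 0.
  have ErE : E r = [set w | a r * X w <= U /\ b r * Y w <= psi (a r * X w)].
    by near: r.
  pose S i := [set w | a r * X w <= s i].
  pose T i := [set w | b r * Y w <= psi (s i)].
  have maX : measurable_fun setT (fun w => a r * X w) by exact: measurable_funM.
  have mbY : measurable_fun setT (fun w => b r * Y w) by exact: measurable_funM.
  have mS i : measurable (S i) by exact: measurable_le_set.
  have mT i : measurable (T i) by exact: measurable_le_set.
  have SS i : S i `<=` S i.+1 by move=> w /= /le_trans; exact.
  have mx u : measurable [set x : R | a r * x <= u].
    by apply: measurable_le_set => //; exact: measurable_funM.
  have my u : measurable [set x : R | b r * x <= u].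
    by apply: measurable_le_set => //; exact: measurable_funM.
  have mShell i : measurable (S i.+1 `&` ~` S i).
    by apply: measurableI => //; exact: measurableC.
  have indS i j : Pr P (S i `&` T j) = Pr P (S i) * Pr P (T j).
    exact: (XY _ _ (mx (s i)) (my (psi (s j)))).
  (* A strip is still the preimage under [X] of a Borel set, so independence gives the probability
     of each rectangle. *)
  have indShell i j : Pr P ((S i.+1 `&` ~` S i) `&` T j) =
      (Pr P (S i.+1) - Pr P (S i)) * Pr P (T j).
    rewrite -Pr_shell//.
    apply: (XY ([set x | a r * x <= s i.+1] `&` ~` [set x | a r * x <= s i])
               _ _ (my (psi (s j)))).
    by apply: measurableI; [exact: mx | apply: measurableC; exact: mx].
  have ESN : E r = E r `&` S N.
    by apply/esym/setIidl; rewrite ErE /S sN => w /= [].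
  have PE : Pr P (E r) = Pr P (E r `&` S 0%N) +
      \sum_(i < N) Pr P (E r `&` (S i.+1 `&` ~` S i)).
    by rewrite {1}ESN Pr_filtration.
  have ab0 : 0 <= a r * b r by rewrite mulr_ge0// ltW.
  have loE : lo r = a r * b r *
      \sum_(i < N) (Pr P (S i.+1) - Pr P (S i)) * Pr P (T i.+1).
    rewrite mulr_sumr; apply: eq_bigr => i _; rewrite /A /B -/(S _) -/(S _) -/(T _).
    by ring.
  have upE : up r = a r * b r * (Pr P (S 0%N) * Pr P (T 0%N) +
      \sum_(i < N) (Pr P (S i.+1) - Pr P (S i)) * Pr P (T i)).
    rewrite mulrDr mulr_sumr /up /A /B; congr (_ + _); first by ring.
    apply: eq_bigr => i _; rewrite -/(S _) -/(S _) -/(T _); ring.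
  rewrite loE upE PE; apply/andP; split; apply: ler_wpM2l => //.
  (* As [psi] is nonincreasing, a rectangle with the height at the right end of its strip lies
     inside the region; below, the height at the left end covers it. *)
  + apply: (@le_trans _ _ (\sum_(i < N) Pr P (E r `&` (S i.+1 `&` ~` S i)))).
      apply: ler_sum => i _; rewrite -indShell; apply: le_Pr.
      * exact: measurableI.
      * exact: measurableI.
      * move=> w [[/= Si nSi] Ti]; split; last by split.
        rewrite ErE/=; split; first exact: (le_trans Si (s_leU _ (ltn_ord i))).
        apply: (le_trans Ti); apply: psi_ni => //; last exact: s_leU.
        by rewrite mulr_ge0// ltW.
    by rewrite lerDr Pr_ge0.
  + apply: lerD.
      rewrite -indS; apply: le_Pr; [exact: measurableI|exact: measurableI|].
      move=> w [+ S0]; rewrite ErE /= => -[_ Ti]; split => //.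
      apply: (le_trans Ti).
      apply: psi_ni => //.
        by rewrite s00 mulr_ge0// ltW.
      by apply: (le_trans S0); exact: s_leU.
    apply: ler_sum => i _; rewrite -indShell; apply: le_Pr.
    * exact: measurableI.
    * exact: measurableI.
    * move=> w [+ [Si nSi]]; rewrite ErE /= => -[aXU Ti]; split => //.
      apply: (le_trans Ti); apply: psi_ni => //.
      by apply/ltW; rewrite ltNge; apply/negP.
- apply: (@cvgr_sum_ord _ _ _ _ N (fun i r => (A i.+1 r - A i r) * B i.+1 r)
    (fun i => (cX * s i.+1 - cX * s i) * (cY * psi (s i.+1)))) => i iN.
  by apply: cvgM; [apply: cvgB; exact: Al|exact: Bl].
- apply: cvgD; first by apply: cvgM; [exact: Al|exact: Bl].
  apply: (@cvgr_sum_ord _ _ _ _ N (fun i r => (A i.+1 r - A i r) * B i r)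
    (fun i => (cX * s i.+1 - cX * s i) * (cY * psi (s i)))) => i iN; apply: cvgM; [by apply: cvgB; exact: Al|].
  by apply: Bl; exact: ltnW.
- by rewrite lloE; have := ler_wpM2l cc0 Fle; lra.
- by rewrite lupE; have := ler_wpM2l cc0 Fge; lra.
Unshelve. all: by end_near.
Qed.

(** * Area of the logarithmic outage region *)

Lemma ln_le_iff (R : realType) (x y : R) : 0 < x -> (ln x <= y) = (x <= expR y).
Proof. by move=> x0; rewrite -ler_expR lnK. Qed.

Definition log_frontier (R : realType) (rate s t u : R) : R :=
  expR ((rate - s * ln (1 + u)) / t) - (1 + u).

(** For [s = 1 - t] the exponential in [log_frontier] is a constant times [1 + u] to the power
    [1 - 1 / t]. At [t = 1 / 2] this exponent is -1, whence the logarithm. *)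
Definition log_frontier_primitive (R : realType) (rate s t u : R) : R :=
  (if t == 1 / 2 then expR (2 * rate) * ln (1 + u)
   else t / (2 * t - 1) * (expR ((rate - s * ln (1 + u)) / t) * (1 + u)))
  - (1 + u) ^+ 2 / 2.

(** The bound on [u] follows from [ln (1 + u) <= ln (1 + u + v)] and [s + t = 1]; it displays the
    region as a subgraph over a bounded interval. *)
Lemma log_region (R : realType) (rate s t u v : R) :
  0 < s -> 0 < t -> s + t = 1 -> 0 <= u -> 0 <= v ->
  (s * ln (1 + u) + t * ln (1 + u + v) <= rate) <->
  (u <= expR rate - 1 /\ v <= log_frontier rate s t u).
Proof.
move=> s0 t0 st u0 v0; have u1 : 0 < 1 + u by rewrite ltr_wpDr.
have uv1 : 0 < 1 + u + v by rewrite ltr_wpDr.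
rewrite lerBrDl -ln_le_iff// /log_frontier lerBrDl -ln_le_iff// ler_pdivlMr//.
rewrite lerBrDl [ln _ * t]mulrC; split; last by case.
move=> H; split => //; apply: le_trans H.
have : ln (1 + u) <= ln (1 + u + v) by rewrite ler_ln ?posrE// lerDl.
have e : ln (1 + u) = (s + t) * ln (1 + u) by rewrite st mul1r.
by move=> luv; rewrite [leLHS]e mulrDl lerD2l ler_pM2l.
Qed.

Lemma log_frontier_nonincreasing (R : realType) (rate s t x y : R) :
  0 < s -> 0 < t -> 0 <= x -> x <= y ->
  log_frontier rate s t y <= log_frontier rate s t x.
Proof.
move=> s0 t0 x0 xy; apply: lerB; last by rewrite lerD2l.
rewrite ler_expR ler_pM2r ?invr_gt0// lerD2l lerN2 ler_pM2l// ler_ln ?posrE//.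
- by rewrite lerD2l.
- by rewrite ltr_wpDr.
- by rewrite ltr_wpDr// (le_trans x0).
Qed.

(** With monotonicity, this makes the frontier nonnegative over the whole base interval. *)
Lemma log_frontier_end (R : realType) (rate s t : R) : 0 < t -> s + t = 1 ->
  log_frontier rate s t (expR rate - 1) = 0.
Proof.
move=> t0 st; rewrite /log_frontier (addrC 1 (expR rate - 1)) subrK expRK.
rewrite (_ : (rate - s * rate) / t = rate) ?subrr//.
have -> : s = 1 - t by lra.
by field; exact: lt0r_neq0.
Qed.

Lemma is_derive_log_frontier_primitive (R : realType) (rate s t u : R) :
  0 < t -> s + t = 1 -> 0 <= u ->
  is_derive u 1 (log_frontier_primitive rate s t) (log_frontier rate s t u).
Proof.
move=> t0 st u0; have u1 : 0 < 1 + u by rewrite ltr_wpDr.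
have t_neq0 : t != 0 by exact: lt0r_neq0.
have u1_neq0 : 1 + u != 0 by exact: lt0r_neq0.
have d1 : is_derive u 1 (fun x : R => 1 + x) 1.
  by apply: is_derive_eq; rewrite add0r mulr1.
have dln : is_derive u 1 (fun x : R => ln (1 + x)) (1 + u)^-1.
  rewrite -[X in is_derive _ _ _ X]mulr1.
  exact: (@is_derive1_comp _ (@ln R) (fun x => 1 + x) u _ _ (is_derive1_ln u1) d1).
have sE : s = 1 - t by lra.
rewrite /log_frontier_primitive /log_frontier; case: (eqVneq t (1 / 2)) => [tE|tN] /=.
  have -> : (rate - s * ln (1 + u)) / t = 2 * rate - ln (1 + u).
    by rewrite sE tE; field.
  rewrite expRD expRN lnK//.
  have -> : (fun u => expR (2 * rate) * ln (1 + u) - (1 + u) ^+ 2 / 2) =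
      (fun u => expR (2 * rate) *: ln (1 + u) - 2^-1 *: ((1 + u) * (1 + u))) :> (R -> R).
    by apply/funext => x; rewrite /GRing.scale/= expr2; ring.
  by apply: is_derive_eq; rewrite /GRing.scale/=; field.
pose h x := (rate - s * ln (1 + x)) / t.
have dh : is_derive u 1 h (- (s / t) * (1 + u)^-1).
  have -> : h = (fun x => t^-1 *: (rate - s *: ln (1 + x))).
    by apply/funext => x; rewrite /GRing.scale/= mulrC.
  apply: is_derive_eq; rewrite /GRing.scale/=; field.
  by rewrite ?u1_neq0 ?t_neq0.
have dE : is_derive u 1 (fun x => expR (h x)) (expR (h u) * (- (s / t) * (1 + u)^-1)).
  exact: (@is_derive1_comp _ (@expR R) h u _ _ (is_derive_expR _) dh).
have -> : (fun x => t / (2 * t - 1) * (expR ((rate - s * ln (1 + x)) / t) *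
      (1 + x)) - (1 + x) ^+ 2 / 2) =
    (fun x => t / (2 * t - 1) *: (expR (h x) * (1 + x)) - 2^-1 *: ((1 + x) * (1 + x))).
  by apply/funext => x; rewrite /GRing.scale/= expr2; ring.
have t21 : 2 * t - 1 != 0.
  by apply: contra_neq tN => H; lra.
apply: is_derive_eq; rewrite /GRing.scale/= -/(h u).
(* The exponential is a common factor; once it is generalized, a rational identity remains. *)
move: (expR (h u)) => eh; rewrite sE; field.
by rewrite u1_neq0 t21 t_neq0.
Qed.

(** By the mean value theorem the increment is the frontier at an intermediate point times [y - x],
    and the frontier is nonincreasing. *)
Lemma log_frontier_mean (R : realType) (rate s t x y : R) :
  0 < s -> 0 < t -> s + t = 1 -> 0 <= x -> x <= y ->
  log_frontier rate s t y * (y - x) <=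
  log_frontier_primitive rate s t y - log_frontier_primitive rate s t x <=
  log_frontier rate s t x * (y - x).
Proof.
move=> s0 t0 st x0 xy.
have dF (z : R) : 0 <= z ->
    is_derive z 1 (log_frontier_primitive rate s t) (log_frontier rate s t z).
  exact: is_derive_log_frontier_primitive.
have [||c] := @MVT_segment R (log_frontier_primitive rate s t)
  (log_frontier rate s t) x y xy.
- by move=> z; rewrite in_itv/= => /andP[xz _]; exact/dF/(le_trans x0)/ltW.
- apply: derivable_within_continuous => z; rewrite in_itv/= => /andP[xz _].
  by have [] := dF z (le_trans x0 xz).
rewrite in_itv/= => /andP[xc cy] ->.
by rewrite !ler_wpM2r ?subr_ge0// log_frontier_nonincreasing// (le_trans x0).
Qed.

Lemma log_frontier_area (R : realType) (rate s t : R) : 0 < t -> s + t = 1 ->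
  log_frontier_primitive rate s t (expR rate - 1) -
  log_frontier_primitive rate s t 0 = gain_bracket rate t.
Proof.
move=> t0 st; have t_neq0 : t != 0 by exact: lt0r_neq0.
have e2 : expR (2 * rate) = expR rate * expR rate.
  by rewrite mulr_natl mulr2n expRD.
rewrite /log_frontier_primitive /gain_bracket.
rewrite (addrC 1 (expR rate - 1)) subrK addr0 expRK ln1.
case: ifPn => [/eqP tE|tN]; first by rewrite e2; field.
have t21 : 2 * t - 1 != 0.
  by apply: contra tN => /eqP H; apply/eqP; lra.
have -> : (rate - s * rate) / t = rate.
  have -> : s = 1 - t by lra.
  by field.
rewrite mulr0 subr0 e2; field.
by rewrite t21/= (_ : 4 * t - 2 = 2 * (2 * t - 1)) ?mulf_neq0//; ring.
Qed.

(** The scalings [a] and [b] are left general because quantization multiplies one of them by a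
    factor that varies with the SNR. *)
Lemma Pr_log_region_cvg (R : realType) (d : measure_display)
    (Omega : measurableType d) (P : probability Omega R)
    (X Y : Omega -> R) (cX cY rate s t : R) (a b : R -> R) :
  measurable_fun setT X -> measurable_fun setT Y ->
  (forall w, 0 <= X w) -> (forall w, 0 <= Y w) -> independent2 P X Y ->
  linear_cdf0 P X cX -> linear_cdf0 P Y cY -> 0 <= cX -> 0 <= cY ->
  0 < rate -> 0 < s -> 0 < t -> s + t = 1 ->
  a r @[r --> +oo] --> +oo -> b r @[r --> +oo] --> +oo ->
  a r * b r * Pr P [set w | s * ln (1 + a r * X w) +
                            t * ln (1 + a r * X w + b r * Y w) <= rate]
    @[r --> +oo] --> cX * cY * gain_bracket rate t.
Proof.
move=> mX mY X0 Y0 XY lX lY cX0 cY0 rate0 s0 t0 st ay by_.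
rewrite -(log_frontier_area rate t0 st).
have U0 : 0 <= expR rate - 1 by rewrite subr_ge0 -expR0 ler_expR ltW.
apply: (@Pr_subgraph_cvg _ _ _ P X Y cX cY (log_frontier rate s t)
  (log_frontier_primitive rate s t) (expR rate - 1) a b (fun r =>
  [set w | s * ln (1 + a r * X w) + t * ln (1 + a r * X w + b r * Y w) <= rate]))
  => //.
- by move=> x y x0 xy _; exact: log_frontier_nonincreasing.
- move=> x x0 xU; rewrite -(log_frontier_end rate t0 st).
  exact: log_frontier_nonincreasing.
- by move=> x y x0 xy _; exact: log_frontier_mean.
- move=> r; have maX : measurable_fun setT (fun w => 1 + a r * X w).
    by apply: measurable_funD => //; exact: measurable_funM.
  apply: measurable_le_set => //; apply: measurable_funD.
    by apply: measurable_funM => //; exact: measurableT_comp maX.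
  apply: measurable_funM => //; apply: measurableT_comp => //.
  by apply: measurable_funD => //; exact: measurable_funM.
- near=> r.
  have ar0 : 0 < a r by near: r; exact: (cvgryPgt _).1 ay 0.
  have br0 : 0 < b r by near: r; exact: (cvgryPgt _).1 by_ 0.
  by apply/seteqP; split => w /=;
    rewrite log_region//; apply: mulr_ge0 => //; exact: ltW.
Unshelve. all: by end_near.
Qed.

(** * Channel gains *)

Lemma gainE (R : realType) (d : measure_display)
    (Omega : measurableType d) (H : Omega -> R[i]) (w : Omega) :
  gain H w = complex.Re (H w) ^+ 2 + complex.Im (H w) ^+ 2.
Proof.
by rewrite /gain; case: (H w) => x y /=; rewrite sqr_sqrtr// addr_ge0 ?sqr_ge0.
Qed.

Lemma gain_ge0 (R : realType) (d : measure_display)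
    (Omega : measurableType d) (H : Omega -> R[i]) (w : Omega) :
  0 <= gain H w.
Proof. by rewrite gainE addr_ge0 ?sqr_ge0. Qed.

Lemma measurable_sqnorm (R : realType) :
  measurable_fun setT (fun p : R * R => p.1 ^+ 2 + p.2 ^+ 2).
Proof.
by apply: measurable_funD; apply: measurable_funX;
  [exact: measurable_fst|exact: measurable_snd].
Qed.

Lemma gain_re_im (R : realType) (d : measure_display)
    (Omega : measurableType d) (H : Omega -> R[i]) :
  gain H = (fun p : R * R => p.1 ^+ 2 + p.2 ^+ 2) \o re_im H.
Proof. by apply/funext => w; rewrite gainE. Qed.

Lemma measurable_gain (R : realType) (d : measure_display)
    (Omega : measurableType d) (H : Omega -> R[i]) :
  complex_rv H -> measurable_fun setT (gain H).
Proof.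
by move=> mH; rewrite gain_re_im; exact: measurableT_comp (@measurable_sqnorm R) mH.
Qed.

Definition independent3 (R : realType) (d : measure_display)
    (Omega : measurableType d) (P : probability Omega R)
    (X Y Z : Omega -> R) : Prop :=
  forall A B C : set R, measurable A -> measurable B -> measurable C ->
    Pr P (X @^-1` A `&` Y @^-1` B `&` Z @^-1` C) =
    Pr P (X @^-1` A) * Pr P (Y @^-1` B) * Pr P (Z @^-1` C).

(** Each gain is a Borel function of the real and imaginary parts, so its events pull back to
    theirs. *)
Lemma gain_independent3 (R : realType) (d : measure_display)
    (Omega : measurableType d) (P : probability Omega R)
    (H1 H2 H3 : Omega -> R[i]) :
  complex_rv H1 -> complex_rv H2 -> complex_rv H3 ->
  mutually_independent3 P H1 H2 H3 ->
  independent3 P (gain H1) (gain H2) (gain H3).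
Proof.
move=> mH1 mH2 mH3 indep A B C mA mB mC.
have mg D : measurable D -> measurable
    ((fun p : R * R => p.1 ^+ 2 + p.2 ^+ 2) @^-1` D).
  by move=> mD; rewrite -[X in measurable X]setTI; exact: measurable_sqnorm.
have mG (H : Omega -> R[i]) D : complex_rv H -> measurable D ->
    measurable (gain H @^-1` D).
  by move=> mH mD; rewrite -[X in measurable X]setTI; exact: measurable_gain.
have := indep _ _ _ (mg _ mA) (mg _ mB) (mg _ mC).
have pE (H : Omega -> R[i]) D : re_im H @^-1`
    ((fun p : R * R => p.1 ^+ 2 + p.2 ^+ 2) @^-1` D) = gain H @^-1` D.
  by rewrite gain_re_im.
rewrite !pE => E.
apply: EFin_inj; rewrite !EFinM !EFin_Pr//; try exact: mG.
by apply: measurableI; [apply: measurableI|]; exact: mG.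
Qed.

(** [Y] will be the direct gain [G02]; it comes first in both pairs because it is the abscissa of
    both outage regions. *)
Lemma independent3_pairs (R : realType) (d : measure_display)
    (Omega : measurableType d) (P : probability Omega R)
    (X Y Z : Omega -> R) :
  independent3 P X Y Z -> independent2 P Y X /\ independent2 P Y Z.
Proof.
move=> H; have PT : Pr P [set: Omega] = 1 by rewrite /Pr probability_setT.
split => A B mA mB.
  have := H B A setT mB mA measurableT.
  by rewrite !preimage_setT setIT PT mulr1 setIC [RHS]mulrC.
have := H setT A B measurableT mA mB.
by rewrite !preimage_setT setTI PT mul1r.
Qed.

(** A linear distribution function at zero excludes an atom there: [r * Pr[r X <= 1]] stays bounded,
    so [Pr[X <= 1 / r]] tends to 0. *)
Lemma linear_cdf0_small (R : realType) (d : measure_display)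
    (Omega : measurableType d) (P : probability Omega R) (X : Omega -> R)
    (c e : R) :
  linear_cdf0 P X c -> 0 < e -> exists2 eta : R, 0 < eta &
    Pr P [set w | X w <= eta] <= e.
Proof.
move=> lX e0.
have : \forall r \near +oo, 0 < r /\ Pr P [set w | r * X w <= 1] <= e.
  near=> r.
  have r0 : 0 < r by near: r; exact: nbhs_pinfty_gt.
  split => //.
  have : `|c * 1 - r * Pr P [set w | r * X w <= 1]| <= 1.
    by near: r; exact: (cvgrPdist_le _ _).1 (lX 1 ler01) _ ltr01.
  rewrite ler_norml mulr1 => /andP[cr _].
  have : c + 1 <= e * r.
    have : (c + 1) / e <= r by near: r; apply: nbhs_pinfty_ge; rewrite num_real.
    by rewrite ler_pdivrMr// [leRHS]mulrC.
  by move=> cer; rewrite -(ler_pM2l r0) [leRHS]mulrC; lra.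
move=> [M [_ MH]]; have [r0 rP] := MH (M + 1) (ltr_pwDr ltr01 (lexx M)).
exists (M + 1)^-1; first by rewrite invr_gt0.
rewrite [X in Pr P X](_ : _ = [set w | (M + 1) * X w <= 1])//.
by apply/seteqP; split => w /=; rewrite -[(M + 1)^-1]mul1r ler_pdivlMr// mulrC.
Unshelve. all: by end_near.
Qed.

Lemma linear_cdf0_scale (R : realType) (d : measure_display)
    (Omega : measurableType d) (P : probability Omega R) (X : Omega -> R)
    (c al u : R) :
  linear_cdf0 P X c -> 0 < al -> 0 <= u ->
  r * Pr P [set w | al * r * X w <= u] @[r --> +oo] --> c * u / al.
Proof.
move=> lX al0 u0.
have H := cvg_comp _ _ (gt0_cvgMry al0 (@cvg_id _ (pinfty_nbhs R))) (lX u u0).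
rewrite mulrC (_ : (fun r => _) = (fun r => al^-1 *
    (al * r * Pr P [set w | al * r * X w <= u]))).
  by apply: cvgM; [exact: cvg_cst|exact: H].
by apply/funext => r; rewrite -mulrA mulKf// gt_eqF.
Qed.

(** With [s] the square root of [g], the quotient is [s / (s + D) * v]. The lower bound amounts to
    [1 <= s + D], which holds since [s = 1 - D / (1 + v)]. *)
Lemma quantized_snr_bounds (R : realType) (D v g : R) :
  0 < D -> D < 1 -> 0 <= v -> g = (1 + v - D) ^+ 2 / (1 + v) ^+ 2 ->
  (1 - D) * v <= g * v / (g + D * Num.sqrt g) <= v.
Proof.
move=> D0 D1 v0 gE; have v1 : 0 < 1 + v by rewrite ltr_wpDr.
pose s := (1 + v - D) / (1 + v).
have s0 : 0 < s by rewrite divr_gt0//; lra.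
have s1 : s <= 1 by rewrite ler_pdivrMr//; lra.
have sD : 1 <= s + D.
  by rewrite -lerBlDr ler_pdivlMr// mulrDr mulr1; nra.
have gs : g = s ^+ 2 by rewrite gE expr_div_n.
rewrite gs sqrtr_sqr gtr0_norm//.
have sD0 : 0 < s + D by rewrite addr_gt0.
have -> : s ^+ 2 * v / (s ^+ 2 + D * s) = s / (s + D) * v.
  field; rewrite !lt0r_neq0//= expr2 -mulrDl mulr_gt0//.
apply/andP; split; last first.
  by rewrite -[leRHS]mul1r ler_wpM2r// ler_pdivrMr// mul1r lerDl ltW.
by rewrite ler_wpM2r// ler_pdivlMr//; nra.
Qed.

(** * The outage terms of DoQF *)

Section DoQF_outage_gain.
Context (R : realType) (d : measure_display) (Omega : measurableType d)
  (P : probability Omega R) (G01 G02 G12 : Omega -> R).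
Hypotheses (mG01 : measurable_fun setT G01) (mG02 : measurable_fun setT G02)
  (mG12 : measurable_fun setT G12).
Hypotheses (G01_ge0 : forall w, 0 <= G01 w) (G02_ge0 : forall w, 0 <= G02 w)
  (G12_ge0 : forall w, 0 <= G12 w).
Hypothesis indep : independent3 P G01 G02 G12.
Context (c01 c02 c12 : R).
Hypotheses (lin01 : linear_cdf0 P G01 c01) (lin02 : linear_cdf0 P G02 c02)
  (lin12 : linear_cdf0 P G12 c12).
Hypotheses (c01_ge0 : 0 <= c01) (c02_ge0 : 0 <= c02) (c12_ge0 : 0 <= c12).
Context (rate t0 alpha0 alpha1 : R).
Hypotheses (rate_gt0 : 0 < rate) (t0_gt0 : 0 < t0) (t0_lt1 : t0 < 1)
  (alpha0_gt0 : 0 < alpha0) (alpha1_gt0 : 0 < alpha1).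
Context (Delta2 phi : R -> R).
Hypotheses (Delta2_gt0 : forall rho : R, 0 < rho -> 0 < Delta2 rho)
  (phi_gt0 : forall rho : R, 0 < rho -> 0 < phi rho)
  (phi_small : phi rho / rho ^+ 2 @[rho --> +oo] --> (0 : R))
  (Delta2_0 : Delta2 rho @[rho --> +oo] --> (0 : R))
  (phi_Delta2_oo :
     phi rho `^ (1 - t0) * Delta2 rho `^ t0 @[rho --> +oo] --> +oo).

(** The largest SNR at which slot 0 alone does not exceed the rate, for the relay and the
    destination alike. *)
Let V : R := expR (rate / t0) - 1.

Let V_ge0 : 0 <= V.
Proof. by rewrite subr_ge0 -expR0 ler_expR divr_ge0// ltW. Qed.

Let t1_gt0 : 0 < 1 - t0. Proof. by rewrite subr_gt0. Qed.

Let slot0_failure (v : R) : 0 <= v -> (t0 * ln (1 + v) <= rate) = (v <= V).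
Proof.
move=> v0; rewrite /V lerBrDl -ln_le_iff ?ltr_wpDr// ler_pdivlMr//.
by rewrite [ln _ * _]mulrC.
Qed.

Let snr_ge0 (G : Omega -> R) (rho : R) w :
  (forall w, 0 <= G w) -> 0 < rho -> 0 <= alpha0 * rho * G w.
Proof. by move=> G0 r0; rewrite !mulr_ge0// ltW. Qed.

Let decode_failureE (rho : R) : 0 < rho ->
  ~` decode_event G01 rate t0 alpha0 rho = [set w | alpha0 * rho * G01 w <= V].
Proof.
move=> rho0; apply/seteqP; split => w /=; rewrite -slot0_failure ?snr_ge0//.
  by move=> /negP; rewrite -leNgt.
by move=> H; apply/negP; rewrite -leNgt.
Qed.

Let mlow (G : Omega -> R) (u v : R) :
  measurable_fun setT G -> measurable [set w | u * G w <= v].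
Proof. by move=> mG; apply: measurable_le_set => //; exact: measurable_funM. Qed.

Let msnr (G : Omega -> R) (u : R) : measurable_fun setT G ->
  measurable_fun setT (fun w => u * G w).
Proof. by move=> mG; exact: measurable_funM. Qed.

Let mrecover (rho : R) : 0 < rho ->
  measurable (recover_event G02 G12 rate t0 alpha0 Delta2 phi rho).
Proof.
move=> rho0; apply: measurable_lt_set => //.
apply: measurable_funM => //; apply: measurableT_comp => //.
apply: measurable_funD => //; apply: measurable_funM; first exact: msnr.
apply: measurable_fun_inv_ge0 => [w|]; first by rewrite addr_ge0 ?snr_ge0.
by apply: measurable_funD => //; exact: msnr.
Qed.

Let near_gt0 : \forall rho \near +oo, 0 < rho :> R.
Proof. exact: nbhs_pinfty_gt. Qed.

Let near_Delta2 (e : R) : 0 < e -> \forall rho \near +oo, Delta2 rho < e.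
Proof.
move=> e0; near=> rho.
have : `|0 - Delta2 rho| < e by near: rho; exact: (cvgrPdist_lt _ _).1 Delta2_0 _ e0.
by rewrite sub0r normrN; apply: le_lt_trans; exact: ler_norm.
Unshelve. all: by end_near.
Qed.

Lemma quantize_event_full :
  \forall rho \near +oo, quantize_event G01 alpha0 Delta2 rho = setT.
Proof.
near=> rho; have rho0 : 0 < rho by near: rho.
have D1 : Delta2 rho < 1 by near: rho; exact: near_Delta2.
apply/seteqP; split => w //= _; apply: (lt_le_trans D1).
by rewrite lerDr snr_ge0.
Unshelve. all: by end_near.
Qed.

Lemma decode_failure_cvg :
  rho * Pr P (~` decode_event G01 rate t0 alpha0 rho) @[rho --> +oo] -->
  c01 * V / alpha0.
Proof.
apply: cvg_trans (linear_cdf0_scale lin01 alpha0_gt0 V_ge0).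
apply: near_eq_cvg; near=> rho; rewrite decode_failureE//; by near: rho.
Unshelve. all: by end_near.
Qed.

Lemma decode_failure_cvg0 :
  Pr P (~` decode_event G01 rate t0 alpha0 rho) @[rho --> +oo] --> (0 : R).
Proof.
have invr0 : rho^-1 @[rho --> +oo] --> (0 : R).
  by apply/gtr0_cvgV0 => //; exact: cvg_id.
rewrite -(mulr0 (c01 * V / alpha0)); apply: cvg_trans (cvgM decode_failure_cvg invr0).
apply: near_eq_cvg; near=> rho; have rho0 : 0 < rho by near: rho.
by rewrite /= mulrAC divff ?mul1r// gt_eqF.
Unshelve. all: by end_near.
Qed.

(** If [G12 w > eta], the ratio inside the logarithm is at least [phi * eta / (1 + V)], while the
    rate to beat is [rate - t0 * ln Delta2]. Recovery then follows once [phi^t1 * Delta2^t0] exceeds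
    a constant depending on [eta] only, so the threshold on [rho] is uniform in [w]. *)
Lemma recover_failure_small (eta : R) : 0 < eta ->
  \forall rho \near +oo, forall w, alpha0 * rho * G02 w <= V ->
    ~ recover_event G02 G12 rate t0 alpha0 Delta2 phi rho w -> G12 w <= eta.
Proof.
move=> eta0; near=> rho; have rho0 : 0 < rho by near: rho.
move=> w uV; apply: contra_notP => /negP; rewrite -ltNge => etaG.
have D0 := Delta2_gt0 rho0; have f0 := phi_gt0 rho0.
have V1 : 0 < 1 + V by rewrite ltr_wpDr.
have u0 : 0 <= alpha0 * rho * G02 w by rewrite snr_ge0.
have big : expR (rate - (1 - t0) * ln (eta / (1 + V))) <
    phi rho `^ (1 - t0) * Delta2 rho `^ t0.
  by near: rho; exact: (cvgryPgt _).1 phi_Delta2_oo _.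
rewrite -ltr_ln ?posrE ?expR_gt0 ?mulr_gt0 ?powR_gt0// expRK in big.
rewrite [X in _ < X]lnM ?posrE ?powR_gt0// !ln_powR in big.
rewrite /recover_event /quantization_rate /=.
rewrite lnM ?posrE ?expR_gt0 ?invr_gt0// expRK lnV ?posrE// mulrBl divfK ?gt_eqF//.
have lnq : ln (phi rho) + ln (eta / (1 + V)) <=
    ln (1 + phi rho * G12 w / (alpha0 * rho * G02 w + 1)).
  have p0 : 0 < eta / (1 + V) by rewrite divr_gt0.
  have u1 : 0 < alpha0 * rho * G02 w + 1 by rewrite ltr_wpDl.
  have q0 : 0 <= phi rho * G12 w / (alpha0 * rho * G02 w + 1).
    by rewrite divr_ge0 ?mulr_ge0// ltW.
  rewrite -lnM ?posrE// ler_ln ?posrE ?(mulr_gt0 f0 p0) ?ltr_wpDr//.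
  apply: ler_wpDl => //; rewrite -mulrA ler_pM2l//.
  apply: ler_pM; [exact: ltW|by rewrite invr_ge0 ltW|exact: ltW|].
  by rewrite lef_pV2 ?posrE// addrC lerD2l.
by have := ler_wpM2l (ltW t1_gt0) lnq; lra.
Unshelve. all: by end_near.
Qed.

(** It serves twice: eventually it is the event of [outage_unrecovered], and it bounds what
    [recover_event] removes from the region of [outage_quantize]. *)
Let unrecovered (rho : R) : set Omega :=
  [set w | alpha0 * rho * G02 w <= V] `&` [set w | alpha0 * rho * G01 w <= V]
  `&` ~` recover_event G02 G12 rate t0 alpha0 Delta2 phi rho.

Let munrecovered (rho : R) : 0 < rho -> measurable (unrecovered rho).
Proof.
move=> rho0; apply: measurableI; last by apply: measurableC; exact: mrecover.
by apply: measurableI; exact: mlow.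
Qed.

(** The event forces three independent gains to be small. Those of [G01] and [G02] account for the
    factor [rho ^+ 2]; [G12 w <= eta] adds a factor as small as desired. *)
Lemma unrecovered_negligible :
  rho ^+ 2 * Pr P (unrecovered rho) @[rho --> +oo] --> (0 : R).
Proof.
apply: approx_squeeze_cvgr => e e0.
pose K := (c01 * V / alpha0) * (c02 * V / alpha0).
have K0 : 0 <= K by rewrite !mulr_ge0 ?invr_ge0// ltW.
have K1 : 0 < K + 1 by rewrite ltr_wpDl.
(* [K] is the limit of the scaled factors of [G01] and [G02], so the bound tends to at most
   [K * (e / (K + 1)) <= e]; the added 1 covers [K = 0]. *)
have [eta eta0 etaP] := linear_cdf0_small lin12 (divr_gt0 e0 K1).
pose p := Pr P [set w | G12 w <= eta].
pose h rho := (rho * Pr P [set w | alpha0 * rho * G01 w <= V]) *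
  (rho * Pr P [set w | alpha0 * rho * G02 w <= V]) * p.
exists (fun=> 0), h, 0, (K * p); split.
- near=> rho; have rho0 : 0 < rho by near: rho.
  rewrite mulr_ge0 ?sqr_ge0 ?Pr_ge0//=.
  have -> : h rho = rho ^+ 2 * Pr P ([set w | alpha0 * rho * G01 w <= V] `&`
      [set w | alpha0 * rho * G02 w <= V] `&` [set w | G12 w <= eta]).
    rewrite (indep (A := [set x | alpha0 * rho * x <= V])
      (B := [set x | alpha0 * rho * x <= V]) (C := [set x | x <= eta])).
    + by rewrite /h /p; ring.
    + by apply: measurable_le_set => //; exact: measurable_funM.
    + by apply: measurable_le_set => //; exact: measurable_funM.
    + exact: measurable_le_set.
  rewrite ler_wpM2l ?sqr_ge0// le_Pr//; first exact: munrecovered.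
    apply: measurableI; last exact: measurable_le_set.
    by apply: measurableI; exact: mlow.
  move=> w [[/= u2 u1] nF]; split; first by split.
  by move: w u2 nF {u1}; near: rho; exact: recover_failure_small.
- exact: cvg_cst.
- apply: cvgM; last exact: cvg_cst.
  by apply: cvgM; exact: linear_cdf0_scale.
- by rewrite sub0r oppr_le0 ltW.
- rewrite add0r; apply: (le_trans (ler_wpM2l K0 etaP)).
  by rewrite mulrCA ler_piMr ?(ltW e0)// ler_pdivrMr// mul1r lerDl.
Unshelve. all: by end_near.
Qed.

Lemma outage_unrecovered_cvg :
  rho ^+ 2 * outage_unrecovered P G01 G02 G12 rate t0 alpha0 Delta2 phi rho
    @[rho --> +oo] --> (0 : R).
Proof.
apply: cvg_trans unrecovered_negligible; apply: near_eq_cvg; near=> rho.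
have rho0 : 0 < rho by near: rho.
have Q : quantize_event G01 alpha0 Delta2 rho = setT.
  by near: rho; exact: quantize_event_full.
rewrite /outage_unrecovered Q setIT decode_failureE//; congr (_ * Pr P _).
by congr (_ `&` _ `&` _); apply/seteqP; split => w /=; rewrite slot0_failure// snr_ge0.
Unshelve. all: by end_near.
Qed.

Lemma outage_silent_cvg :
  rho ^+ 2 * outage_silent P G01 G02 rate t0 alpha0 Delta2 rho
    @[rho --> +oo] --> (0 : R).
Proof.
apply: cvg_near_cst; near=> rho.
have Q : quantize_event G01 alpha0 Delta2 rho = setT.
  by near: rho; exact: quantize_event_full.
by rewrite /outage_silent Q setCT setI0 /Pr measure0 mulr0.
Unshelve. all: by end_near.
Qed.

Lemma outage_decode_cvg :
  rho ^+ 2 * outage_decode P G01 G02 G12 rate t0 alpha0 alpha1 rho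
    @[rho --> +oo] -->
  c02 * c12 / (alpha0 * alpha1) * gain_bracket rate (1 - t0).
Proof.
have [_ ind] := independent3_pairs indep.
have a_oo (al : R) : 0 < al -> al * rho @[rho --> +oo] --> +oo.
  by move=> al0; exact: (gt0_cvgMry al0 (@cvg_id _ (pinfty_nbhs R))).
have LP := Pr_log_region_cvg mG02 mG12 G02_ge0 G12_ge0 ind lin02 lin12 c02_ge0
  c12_ge0 rate_gt0 t0_gt0 t1_gt0 (subrKC _ _) (a_oo _ alpha0_gt0) (a_oo _ alpha1_gt0).
have aa : alpha0 * alpha1 != 0 by rewrite mulf_neq0 ?gt_eqF.
have decode1 : 1 - Pr P (~` decode_event G01 rate t0 alpha0 rho)
    @[rho --> +oo] --> (1 - 0 : R).
  by apply: cvgB; [exact: cvg_cst|exact: decode_failure_cvg0].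
have -> : c02 * c12 / (alpha0 * alpha1) * gain_bracket rate (1 - t0) =
    (alpha0 * alpha1)^-1 * (c02 * c12 * gain_bracket rate (1 - t0)) * (1 - 0).
  by rewrite subr0; ring.
apply: cvg_trans (cvgM (cvgM (cvg_cst (alpha0 * alpha1)^-1) LP) decode1).
apply: near_eq_cvg; near=> rho; rewrite /outage_decode /=.
by field; rewrite !gt_eqF.
Unshelve. all: by end_near.
Qed.

(** Decoding fails with probability of order [1 / rho], so the quantizing power divided by [rho] is
    [phi / rho ^+ 2] times a convergent factor. *)
Lemma doqf_relay_power_cvg :
  doqf_relay_power P G01 rate t0 alpha0 alpha1 Delta2 phi rho / rho
    @[rho --> +oo] --> alpha1.
Proof.
have decode1 : 1 - Pr P (~` decode_event G01 rate t0 alpha0 rho)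
    @[rho --> +oo] --> (1 - 0 : R).
  by apply: cvgB; [exact: cvg_cst|exact: decode_failure_cvg0].
have H : alpha1 * (1 - Pr P (~` decode_event G01 rate t0 alpha0 rho)) +
    phi rho / rho ^+ 2 * (rho * Pr P (~` decode_event G01 rate t0 alpha0 rho))
    @[rho --> +oo] --> alpha1.
  rewrite -[X in _ --> X]addr0 -[X in X + _]mulr1 -[X in _ * X + _]subr0.
  rewrite -[X in _ + X](mul0r (c01 * V / alpha0)).
  by apply: cvgD; apply: cvgM => //; [exact: cvg_cst|exact: decode_failure_cvg].
apply: cvg_trans H.
apply: near_eq_cvg; near=> rho; have rho0 : 0 < rho by near: rho.
have Q : quantize_event G01 alpha0 Delta2 rho = setT.
  by near: rho; exact: quantize_event_full.
rewrite /doqf_relay_power Q setIT /=.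
by field; rewrite gt_eqF.
Unshelve. all: by end_near.
Qed.

(** * The quantizing term and the total outage *)

Let joint_failure (b rho : R) : set Omega :=
  [set w | (1 - t0) * ln (1 + alpha0 * rho * G02 w) +
           t0 * ln (1 + alpha0 * rho * G02 w + b * G01 w) <= rate].

Let quantized_failure (rho : R) : set Omega :=
  [set w | (1 - t0) * ln (1 + alpha0 * rho * G02 w)
           + t0 * ln (1 + alpha0 * rho * G02 w
               + gamma alpha0 Delta2 (G01 w) rho * alpha0 * rho * G01 w
                 / (gamma alpha0 Delta2 (G01 w) rho
                    + Delta2 rho * Num.sqrt (gamma alpha0 Delta2 (G01 w) rho)))
           <= rate].

Let mlog (f : Omega -> R) (c : R) : measurable_fun setT f ->
  measurable_fun setT (fun w => c * ln (f w)).
Proof. by move=> mf; apply: measurable_funM => //; exact: measurableT_comp. Qed.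

Let mjoint_failure (b rho : R) : measurable (joint_failure b rho).
Proof.
apply: measurable_le_set => //; apply: measurable_funD; apply: mlog.
  by apply: measurable_funD => //; exact: msnr.
by apply: measurable_funD; [apply: measurable_funD => //|]; exact: msnr.
Qed.

Let mquantized_failure (rho : R) : 0 < rho -> measurable (quantized_failure rho).
Proof.
move=> rho0; have D0 := Delta2_gt0 rho0.
have m1 : measurable_fun setT (fun w => 1 + alpha0 * rho * G01 w).
  by apply: measurable_funD => //; exact: msnr.
have g0 w : 0 <= gamma alpha0 Delta2 (G01 w) rho.
  by rewrite divr_ge0 ?sqr_ge0.
have mg : measurable_fun setT (fun w => gamma alpha0 Delta2 (G01 w) rho).
  apply: measurable_funM; first by apply: measurable_funX; exact: measurable_funB.
  apply: measurable_fun_inv_ge0 => [w|]; first exact: sqr_ge0.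
  exact: measurable_funX.
apply: measurable_le_set => //; apply: measurable_funD; apply: mlog.
  by apply: measurable_funD => //; exact: msnr.
apply: measurable_funD; first by apply: measurable_funD => //; exact: msnr.
apply: measurable_funM.
  by do 3 apply: measurable_funM => //.
apply: measurable_fun_inv_ge0 => [w|].
  by rewrite addr_ge0// mulr_ge0 ?sqrtr_ge0// ltW.
apply: measurable_funD => //; apply: measurable_funM => //.
exact: measurable_fun_sqrt_ge0.
Qed.

Let mdecode_failure (rho : R) : 0 < rho ->
  measurable (~` decode_event G01 rate t0 alpha0 rho).
Proof. by move=> rho0; rewrite decode_failureE//; exact: mlow. Qed.

(** Outage decreases with the effective SNR, so the bounds of [quantized_snr_bounds] become
    inclusions in the opposite order. *)
Let quantized_failure_bounds (rho : R) w : 0 < rho -> Delta2 rho < 1 ->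
  (joint_failure (alpha0 * rho) rho w -> quantized_failure rho w) /\
  (quantized_failure rho w ->
    joint_failure (alpha0 * rho * (1 - Delta2 rho)) rho w).
Proof.
move=> rho0 D1; have D0 := Delta2_gt0 rho0.
have u0 : 0 <= alpha0 * rho * G02 w by exact: snr_ge0.
have v0 : 0 <= alpha0 * rho * G01 w by exact: snr_ge0.
have /andP[lov upv] := quantized_snr_bounds D0 D1 v0
  (erefl : gamma alpha0 Delta2 (G01 w) rho = _).
rewrite /quantized_failure /joint_failure /=.
have -> : gamma alpha0 Delta2 (G01 w) rho * alpha0 * rho * G01 w =
  gamma alpha0 Delta2 (G01 w) rho * (alpha0 * rho * G01 w) by ring.
set v' := _ / _ in lov upv *.
have v'0 : 0 <= v' by apply: le_trans lov; rewrite mulr_ge0// subr_ge0 ltW.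
have pos x : 0 <= x -> 0 < 1 + alpha0 * rho * G02 w + x.
  by move=> x0; rewrite ltr_wpDr// ltr_wpDr.
have w0 : 0 <= alpha0 * rho * (1 - Delta2 rho) * G01 w.
  by rewrite mulrAC mulr_ge0// subr_ge0 ltW.
have lov' : alpha0 * rho * (1 - Delta2 rho) * G01 w <= v'.
  by rewrite mulrAC mulrC.
by split; apply: le_trans;
  rewrite lerD2l ler_pM2l// ler_ln ?posrE ?pos// lerD2l.
Qed.

Let joint_failure_cvg (k : R -> R) : k rho @[rho --> +oo] --> (1 : R) ->
  rho ^+ 2 * Pr P (joint_failure (alpha0 * rho * k rho) rho) @[rho --> +oo] -->
  c02 * c01 / alpha0 ^+ 2 * gain_bracket rate t0.
Proof.
move=> k1; have [ind _] := independent3_pairs indep.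
have a_oo (al : R) : 0 < al -> al * rho @[rho --> +oo] --> +oo.
  by move=> al0; exact: (gt0_cvgMry al0 (@cvg_id _ (pinfty_nbhs R))).
(* This makes the second scaling tend to infinity and allows dividing by [k rho]. *)
have near_k : \forall rho \near +oo, 2^-1 < k rho.
  have h0 : 0 < 2^-1 :> R by rewrite invr_gt0.
  near=> rho.
  have : `|1 - k rho| < 2^-1 by near: rho; exact: (cvgrPdist_lt _ _).1 k1 _ h0.
  by rewrite ltr_norml; lra.
have b_oo : alpha0 * rho * k rho @[rho --> +oo] --> +oo.
  apply: (@ger_cvgy _ _ _ _ (fun rho => alpha0 / 2 * rho)).
    near=> rho; have rho0 : 0 < rho by near: rho.
    by rewrite mulrAC ler_pM2l ?mulr_gt0// ltW//; near: rho.
  by apply: a_oo; rewrite divr_gt0.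
have LP := Pr_log_region_cvg mG02 mG01 G02_ge0 G01_ge0 ind lin02 lin01 c02_ge0
  c01_ge0 rate_gt0 t1_gt0 t0_gt0 (subrK _ _) (a_oo _ alpha0_gt0) b_oo.
have k1V : (k rho)^-1 @[rho --> +oo] --> (1^-1 : R).
  by apply: cvgV => //; exact: oner_neq0.
have -> : c02 * c01 / alpha0 ^+ 2 * gain_bracket rate t0 =
    (alpha0 ^+ 2)^-1 * 1^-1 * (c02 * c01 * gain_bracket rate t0).
  by rewrite invr1; ring.
apply: cvg_trans (cvgM (cvgM (cvg_cst (alpha0 ^+ 2)^-1) k1V) LP).
apply: near_eq_cvg; near=> rho; rewrite /joint_failure /=.
have k0 : k rho != 0.
  by rewrite gt_eqF//; apply: (@lt_trans _ _ 2^-1); [rewrite invr_gt0|near: rho].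
by field; rewrite k0 gt_eqF.
Unshelve. all: by end_near.
Qed.

(** The event lies in the joint region for the SNR reduced by [1 - Delta2], and contains the
    unreduced joint region up to [unrecovered]. Both bounds have the same limit. *)
Lemma outage_quantize_cvg :
  rho ^+ 2 * outage_quantize P G01 G02 G12 rate t0 alpha0 Delta2 phi rho
    @[rho --> +oo] --> c02 * c01 / alpha0 ^+ 2 * gain_bracket rate t0.
Proof.
have k1 : 1 - Delta2 rho @[rho --> +oo] --> (1 : R).
  rewrite -[X in _ --> X]subr0.
  by apply: cvgB; [exact: cvg_cst|exact: Delta2_0].
have up := joint_failure_cvg k1.
have lo : rho ^+ 2 * Pr P (joint_failure (alpha0 * rho * 1) rho) -
    rho ^+ 2 * Pr P (unrecovered rho) @[rho --> +oo] -->
    c02 * c01 / alpha0 ^+ 2 * gain_bracket rate t0.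
  rewrite -[X in _ --> X]subr0; apply: cvgB; last exact: unrecovered_negligible.
  by apply: (joint_failure_cvg (k := fun=> 1)); exact: cvg_cst.
apply: (squeeze_cvgr _ lo up); near=> rho.
have rho0 : 0 < rho by near: rho.
have D1 : Delta2 rho < 1 by near: rho; exact: near_Delta2.
have Q : quantize_event G01 alpha0 Delta2 rho = setT.
  by near: rho; exact: quantize_event_full.
rewrite /outage_quantize -/(quantized_failure rho) Q setIT mulr1 -mulrBr.
have bounds w := quantized_failure_bounds w rho0 D1.
have mE : measurable (quantized_failure rho `&`
    ~` decode_event G01 rate t0 alpha0 rho `&`
    recover_event G02 G12 rate t0 alpha0 Delta2 phi rho).
  apply: measurableI; last exact: mrecover.
  by apply: measurableI; [exact: mquantized_failure|exact: mdecode_failure].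
have mN := munrecovered rho0.
have mL := mjoint_failure (alpha0 * rho) rho.
apply/andP; split; apply: ler_wpM2l; rewrite ?sqr_ge0//; last first.
  by apply: le_Pr => // w [[/(bounds w).2]].
rewrite lerBlDr (Pr_setID P mL mE); apply: lerD.
  by apply: le_Pr; [exact: measurableI|exact: mE|exact: subIsetr].
apply: le_Pr => //; first by apply: measurableI => //; exact: measurableC.
move=> w [Lw nE]; have u0 : 0 <= alpha0 * rho * G02 w by exact: snr_ge0.
have v0 : 0 <= alpha0 * rho * G01 w by exact: snr_ge0.
have luv : ln (1 + alpha0 * rho * G02 w) <=
    ln (1 + alpha0 * rho * G02 w + alpha0 * rho * G01 w).
  by rewrite ler_ln ?posrE ?lerDl ?ltr_wpDr.
have lvu : ln (1 + alpha0 * rho * G01 w) <=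
    ln (1 + alpha0 * rho * G02 w + alpha0 * rho * G01 w).
  by rewrite ler_ln ?posrE ?ltr_wpDr// lerD2r lerDl.
have lu0 : 0 <= ln (1 + alpha0 * rho * G02 w) by rewrite ln_ge0// lerDl.
(* The logarithm of the sum dominates that of each link and the other summand is nonnegative, so
   joint failure entails slot 0 failure on both links. Only a lost index can then exclude the point
   from the quantizing event. *)
have Nu : alpha0 * rho * G02 w <= V.
  rewrite -slot0_failure//; apply: le_trans Lw.
  by rewrite ler_wpDl ?mulr_ge0 ?(ltW t1_gt0)// ler_pM2l.
have Nv : alpha0 * rho * G01 w <= V.
  rewrite -slot0_failure//; apply: le_trans Lw.
  by rewrite ler_wpDl ?mulr_ge0 ?(ltW t1_gt0)// ler_pM2l.
split; first by split.
move=> Fw; apply: nE; split => //; split; first exact: (bounds w).1.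
by rewrite decode_failureE.
Unshelve. all: by end_near.
Qed.

Lemma outage_probability_cvg :
  rho ^+ 2 * outage_probability P G01 G02 G12 rate t0 alpha0 alpha1 Delta2 phi rho
    @[rho --> +oo] --> xi_CS_HD c01 c02 c12 rate t0 alpha0 alpha1.
Proof.
(* The two zeros are the limits of the unrecovered and silent terms; the swap puts the decoding term
   first, as in [outage_probability]. *)
rewrite /xi_CS_HD -[X in _ --> X]addr0 -[X in _ --> X]addr0.
rewrite [X in _ --> X + 0 + 0]addrC.
under eq_fun do rewrite /outage_probability !mulrDr.
apply: cvgD; last exact: outage_silent_cvg.
apply: cvgD; last exact: outage_unrecovered_cvg.
by apply: cvgD; [exact: outage_decode_cvg|exact: outage_quantize_cvg].
Qed.

End DoQF_outage_gain.

Theorem theorem2 (R : realType) (d : measure_display)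
    (Omega : measurableType d) (P : probability Omega R)
    (H01 H02 H12 : Omega -> R[i])
    (mH01 : complex_rv H01) (mH02 : complex_rv H02) (mH12 : complex_rv H12)
    (indep : mutually_independent3 P H01 H02 H12)
    (f01 f02 f12 : R -> R)
    (dens01 : is_density P (gain H01) f01)
    (dens02 : is_density P (gain H02) f02)
    (dens12 : is_density P (gain H12) f12)
    (rc01 : right_continuous0 f01) (rc02 : right_continuous0 f02)
    (rc12 : right_continuous0 f12)
    (c01_gt0 : 0 < right_lim0 f01) (c02_gt0 : 0 < right_lim0 f02)
    (c12_gt0 : 0 < right_lim0 f12)
    (rate t0 alpha0 alpha1 : R)
    (rate_gt0 : 0 < rate) (t0_gt0 : 0 < t0) (t0_lt1 : t0 < 1)
    (alpha0_gt0 : 0 < alpha0) (alpha1_gt0 : 0 < alpha1)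
    (Delta2 phi : R -> R)
    (Delta2_gt0 : forall rho : R, 0 < rho -> 0 < Delta2 rho)
    (phi_gt0 : forall rho : R, 0 < rho -> 0 < phi rho)
    (phi_oo : phi rho @[rho --> +oo] --> +oo)
    (phi_small : phi rho / rho ^+ 2 @[rho --> +oo] --> (0 : R))
    (Delta2_0 : Delta2 rho @[rho --> +oo] --> (0 : R))
    (phi_Delta2_oo :
       phi rho `^ (1 - t0) * Delta2 rho `^ t0 @[rho --> +oo] --> +oo) :
  in_PHD rate t0 alpha0 alpha1
    (doqf_protocol P (gain H01) rate t0 alpha0 alpha1 Delta2 phi)
  /\ rho ^+ 2 * outage_probability P (gain H01) (gain H02) (gain H12)
                  rate t0 alpha0 alpha1 Delta2 phi rho @[rho --> +oo] -->
     xi_CS_HD (right_lim0 f01) (right_lim0 f02) (right_lim0 f12)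
       rate t0 alpha0 alpha1.
Proof.
have indG := gain_independent3 mH01 mH02 mH12 indep.
have mG01 := measurable_gain mH01.
have mG02 := measurable_gain mH02.
have mG12 := measurable_gain mH12.
have G_ge0 := @gain_ge0 R d Omega.
have lin01 := density_linear_cdf0 mG01 (G_ge0 H01) dens01 rc01.
have lin02 := density_linear_cdf0 mG02 (G_ge0 H02) dens02 rc02.
have lin12 := density_linear_cdf0 mG12 (G_ge0 H12) dens12 rc12.
split; last first.
  by apply: outage_probability_cvg => //; exact: ltW.
(* The dictionary and listening conditions hold by definition; the two power limits remain. *)
split => //.
  exists alpha0 => //; apply: cvg_near_cst; near=> rho.
  by rewrite /= mulfK// gt_eqF//; near: rho; exact: nbhs_pinfty_gt.
by exists alpha1 => //; exact: (doqf_relay_power_cvg (G_ge0 H01) lin01).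
Unshelve. all: by end_near.
Qed.
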